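(* Let $I$ be a non-empty subset of $\mathbb{N}$ and let $S\subseteq\mathbb{N}^{(I)}$ be a gap absorbing monoid. Then, for every $\mathbf{s}\in S$, the set of lengths $\mathsf{L}(\mathbf{s})$ is an interval of integers.
   Context: $\mathbb{N}$ is the set of non-negative integers. For a non-empty set $I\subseteq\mathbb{N}$, $\mathbb{N}^{(I)}$ is the additive monoid (componentwise addition) of all sequences $(n_i)_{i\in I}$ of non-negative integers with $n_i=0$ for all but finitely many $i$; $\mathbf{0}$ is the zero sequence. For $X,Y\subseteq\mathbb{N}^{(I)}$, $X+Y=\{x+y: x\in X,\ y\in Y\}$, $0X=\{\mathbf{0}\}$ and $nX=(n-1)X+X$ for $n>0$. For a submonoid $S$ of $\mathbb{N}^{(I)}$: $S^*=S\setminus\{\mathbf{0}\}$; $\mathcal{H}(S)=\mathbb{N}^{(I)}\setminus S$ is the set of gaps; $\mathcal{A}(S)=S^*\setminus(S^*+S^* )$ is the set of atoms. A submonoid $S$ of $\mathbb{N}^{(I)}$ is gap absorbing if $2\mathcal{H}(S)\subseteq\mathcal{H}(S)\cup\mathcal{A}(S)\cup 2\mathcal{A}(S)$ and $\mathcal{H}(S)+\mathcal{A}(S)\subseteq\mathcal{A}(S)\cup 2\mathcal{A}(S)$. For $\mathbf{s}\in S$, $\mathsf{L}(\mathbf{s})$ is the set of lengths of factorizations of $\mathbf{s}$ into atoms, i.e. $\mathsf{L}(\mathbf{s})=\{n\in\mathbb{N}:\mathbf{s}\in n\mathcal{A}(S)\}$ (a finite set). An interval of integers is a set of consecutive integers.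 *)

(* Defs.v *)
From mathcomp Require Import all_boot finmap multiset.
From mathcomp Require Import all_classical.

Set Implicit Arguments.
Unset Strict Implicit.
Unset Printing Implicit Defensive.

Local Open Scope classical_set_scope.

(* [{mset K}] is the type of finitely supported functions [K -> nat], with
   pointwise addition [msetD] and zero function [mset0]; for [I : set nat],
   [N_fin I] is therefore the additive monoid N^(I). *)
Definition N_fin (I : set nat) : Type := {mset I}%mset.

Section GapAbsorbing.
Context {I : set nat}.
Implicit Types X Y S : set (N_fin I).

Definition sumset X Y : set (N_fin I) :=
  [set msetD x y | x in X & y in Y].

Fixpoint nfold_sumset (n : nat) X : set (N_fin I) :=
  if n is n'.+1 then sumset (nfold_sumset n' X) X else [set mset0].

Definition is_submonoid S : Prop :=
  S mset0 /\ (forall x y, S x -> S y -> S (msetD x y)).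

Definition nonzero S : set (N_fin I) := S `\ mset0.

Definition gaps S : set (N_fin I) := ~` S.

Definition atoms S : set (N_fin I) :=
  nonzero S `\` sumset (nonzero S) (nonzero S).

Definition gap_absorbing S : Prop :=
  [/\ is_submonoid S,
      nfold_sumset 2 (gaps S) `<=`
        gaps S `|` atoms S `|` nfold_sumset 2 (atoms S) &
      sumset (gaps S) (atoms S) `<=`
        atoms S `|` nfold_sumset 2 (atoms S)].

Definition lengths S (s : N_fin I) : set nat :=
  [set n | nfold_sumset n (atoms S) s].

End GapAbsorbing.

(* Only bounded, non-empty intervals are needed: sets of lengths are finite
   and non-empty. *)
Definition is_nat_interval (L : set nat) : Prop :=
  exists m n : nat, (m <= n)%N /\ L = [set k | (m <= k <= n)%N].

(* Main.v *)
Require Import Defs.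
From mathcomp Require Import all_boot finmap multiset.
From mathcomp Require Import all_classical.

(** The key point is that any [d <= a_1 + ... + a_m], with the [a_i] atoms, is
    either a gap or a sum of at most [m] atoms. Indeed [d = d_1 + ... + d_m] with
    [d_i <= a_i], and each [d_i] is zero, a gap or an atom; gap absorption then
    merges any two summands one of which is a gap, without ever increasing
    their number.
    Now let [s] have factorizations of lengths [m < n], and let [b] be an atom of
    the longer one. Then [s - b] lies in [S], so it has a factorization of some
    length [k <= m], as well as one of length [n - 1]; by induction on [n] it has
    factorizations of all lengths in [[m, n - 1]], and adding [b] gives all
    lengths in [[m + 1, n]] for [s]. *)

Local Open Scope classical_set_scope.

(** The size, i.e. the sum of all coordinates, is an additive weight that is positive off zero: it
    drives the induction for factorizations and bounds their lengths. *)
Lemma size_msetD (K : choiceType) (A B : {mset K}%mset) :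
  size (A `+` B)%mset = size A + size B.
Proof.
rewrite -size_cat; apply/perm_size/eq_seq_msetP/msetP => x.
by rewrite seq_mset_id mset_seqE count_cat !count_mem_mset msetE2.
Qed.

Section GapAbsorbing.
Set Implicit Arguments.
Unset Strict Implicit.
Context {I : set nat}.
Implicit Types X S : set (N_fin I).

Lemma nfold_sumset_msetD n X x y :
  nfold_sumset n X x -> X y -> nfold_sumset n.+1 X (msetD x y).
Proof. by move=> Xx Xy; exists x => //; exists y. Qed.

Lemma nfold_sumset1 X x : X x -> nfold_sumset 1 X x.
Proof. by move=> Xx; exists mset0 => //; exists x => //; rewrite mset0D. Qed.

Lemma nfold_sumset2 X x y : X x -> X y -> nfold_sumset 2 X (msetD x y).
Proof. by move=> /nfold_sumset1; exact: nfold_sumset_msetD. Qed.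

Lemma nfold_sumsetD n k X x y : nfold_sumset n X x -> nfold_sumset k X y ->
  nfold_sumset (n + k) X (msetD x y).
Proof.
move=> Xx; elim: k y => [y ->|k IHk _ [y Xy [z Xz <-]]].
  by rewrite addn0 msetD0.
by rewrite addnS msetDA; apply: nfold_sumset_msetD => //; exact: IHk.
Qed.

Lemma nfold_sumset_sub n X S : is_submonoid S -> X `<=` S ->
  nfold_sumset n X `<=` S.
Proof.
move=> [S0 SD] XS; elim: n => [_ -> //|n IHn _ [x /IHn Sx [y /XS Sy <-]]].
exact: SD.
Qed.

Lemma atoms_sub S : atoms S `<=` S.
Proof. by move=> a [[]]. Qed.

Lemma atoms_neq0 S a : atoms S a -> a <> mset0.
Proof. by move=> [[]]. Qed.

Lemma atoms_irreducible S x y :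
  nonzero S x -> nonzero S y -> ~ atoms S (msetD x y).
Proof. by move=> Sx Sy [_]; apply; exists x => //; exists y. Qed.

Lemma size_gt0 (x : N_fin I) : x <> mset0 -> 0 < size (enum_mset x).
Proof. by move=> /eqP; rewrite -size_mset_eq0 lt0n. Qed.

Lemma nonatomP S x : nonzero S x -> ~ atoms S x ->
  exists y z, [/\ nonzero S y, nonzero S z & x = msetD y z].
Proof.
move=> Sx nAx; have [[y Sy [z Sz <-]]|nSS] := pselect (sumset (nonzero S) (nonzero S) x).
  by exists y, z.
by case: nAx; split.
Qed.

(** Strong induction on size: a nonzero non-atom splits into two nonzero elements, each of strictly
    smaller size. *)
Lemma factorization S x : S x -> exists n, lengths S x n.
Proof.
have [n] := ubnP (size (enum_mset x)); elim: n x => // n IHn x; rewrite ltnS => lexn Sx.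
have [->|x0] := pselect (x = mset0); first by exists 0.
have [Ax|nAx] := pselect (atoms S x); first by exists 1; exact: nfold_sumset1.
have [y [z [[Sy y0] [Sz z0] xE]]] := nonatomP (x := x) (conj Sx x0) nAx.
move: lexn; rewrite {}xE size_msetD => len.
have [|k Lk] := IHn y _ Sy.
  by rewrite (leq_trans _ len)// -[ltnLHS]addn0 ltn_add2l size_gt0.
have [|l Ll] := IHn z _ Sz.
  by rewrite (leq_trans _ len)// -[ltnLHS]add0n ltn_add2r size_gt0.
by exists (k + l); exact: nfold_sumsetD.
Qed.

Lemma lengths_le_size S x n : lengths S x n -> n <= size (enum_mset x).
Proof.
elim: n x => // n IHn _ [x /IHn lenx [a /atoms_neq0/size_gt0 a_gt0 <-]].
by rewrite size_msetD -addn1 leq_add.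
Qed.

Lemma nonatom_atom_split S x : is_submonoid S -> nonzero S x -> ~ atoms S x ->
  exists y a, [/\ nonzero S y, atoms S a & x = msetD y a].
Proof.
move=> Smon [Sx x0] nAx; case: (factorization Sx) => -[//|[|n]].
  by move=> [_ -> [a Aa aE]]; case: nAx; rewrite -aE mset0D.
move=> [y Ly [a Aa <-]]; exists y, a; split => //; split.
  exact: (nfold_sumset_sub (n := n.+1) Smon (@atoms_sub S) Ly).
(* The factorization has length at least 2, so [y] keeps at least one atom and has positive size. *)
by move=> y0; have := lengths_le_size (n := n.+1) Ly; rewrite y0 size_mset0.
Qed.

Context {S : set (N_fin I)} (hS : gap_absorbing S).

Let S_monoid : is_submonoid S. Proof. by case: hS. Qed.

Lemma gapD_atom h a : gaps S h -> atoms S a ->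
  atoms S (msetD h a) \/ nfold_sumset 2 (atoms S) (msetD h a).
Proof. by case: hS => _ _ + Hh Aa; apply; exists h => //; exists a. Qed.

Lemma gapD_gap h h' : gaps S h -> gaps S h' ->
  [\/ gaps S (msetD h h'), atoms S (msetD h h') |
      nfold_sumset 2 (atoms S) (msetD h h')].
Proof.
case: hS => _ HH _ Hh Hh'.
by case: (HH _ (nfold_sumset2 Hh Hh')) => [[]|]; [exact: Or31|exact: Or32|exact: Or33].
Qed.

Lemma gapD_atom_nonzero h a : gaps S h -> atoms S a -> nonzero S (msetD h a).
Proof.
move=> Hh Aa; split.
  case: (gapD_atom Hh Aa) => [/atoms_sub//|].
  exact: (nfold_sumset_sub S_monoid (@atoms_sub S)).
move=> /eqP; rewrite -size_mset_eq0 size_msetD addn_eq0 => /andP[_].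
by rewrite size_mset_eq0 => /eqP/(atoms_neq0 Aa).
Qed.

Lemma divisor_atom a d : atoms S a -> msubset d a ->
  [\/ d = mset0, gaps S d | atoms S d].
Proof.
move=> Aa /msetBDK; set c := msetB a d => aE.
have [->|d0] := pselect (d = mset0); first exact: Or31.
have [Sd|Hd] := pselect (S d); last exact: Or32.
have [Ad|nAd] := pselect (atoms S d); first exact: Or33.
(* A decomposable [d] would decompose [a]. If the complement [c] is a gap, it is moved onto an atom
   [u] of [d]: [a] is [y] plus [c + u], and gap absorption puts [c + u] in [S]. *)
exfalso; have [Sc|Hc] := pselect (S c).
  have [c0|c0] := pselect (c = mset0).
    by apply: nAd; move: Aa; rewrite -aE c0 mset0D.
  by move: Aa; rewrite -aE; apply: atoms_irreducible.
have [y [u [Sy Au dE]]] := nonatom_atom_split S_monoid (conj Sd d0) nAd.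
move: Aa; rewrite -aE dE msetDCA.
by apply: atoms_irreducible => //; exact: gapD_atom_nonzero.
Qed.

(* The condition [0 < m] is what lets the induction merge two gaps into up to
   two atoms within the bound [m.+1]. *)
Lemma divisor_atom_sum m w d : nfold_sumset m (atoms S) w -> msubset d w ->
  0 < m /\ gaps S d \/ exists2 k, k <= m & nfold_sumset k (atoms S) d.
Proof.
elim: m w d => [_ d -> /=|m IHm _ d [w Lw [a Aa <-]] led].
  by rewrite msubset0 => /eqP ->; right; exists 0.
(* Subtraction is truncated, so [d] splits into a part below [w] and an excess below [a]. *)
have dE : d = msetD (msetI d w) (msetB d w).
  by apply/msetP => x; rewrite !msetE2 minnE subnK ?leq_subr.
have leda : msubset (msetB d w) a by rewrite subset_msetBLR.
have ledw : msubset (msetI d w) w by apply/msubsetP => x; rewrite msetE2 geq_minr.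
move: (msetI d w) (msetB d w) dE (IHm _ _ Lw ledw) (divisor_atom Aa leda).
move=> x y -> {led ledw leda d}.
case=> [[m_gt0 Hx]|[k lekm Lx]] [->|Hy|Ay].
- by left; rewrite msetD0.
- case: (gapD_gap Hx Hy) => [Hxy|Axy|Lxy]; first by left.
  + by right; exists 1 => //; exact: nfold_sumset1.
  + by right; exists 2.
- right; case: (gapD_atom Hx Ay) => [Axy|Lxy]; last by exists 2.
  by exists 1 => //; exact: nfold_sumset1.
- by right; rewrite msetD0; exists k => //; exact: leqW.
(* The gap [y] is absorbed by one atom [b] of [x]; the two become one or two atoms, so the count
   grows by at most one. *)
- case: k lekm Lx => [_ ->|k ltkm [z Lz [b Ab <-]]].
    by left; rewrite mset0D.
  right; rewrite -msetDA (msetDC b).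
  case: (gapD_atom Hy Ab) => [Ayb|Lyb].
    by exists k.+1; [exact: leqW|exact: nfold_sumset_msetD].
  by exists (k + 2); [rewrite addn2|exact: nfold_sumsetD].
- by right; exists k.+1 => //; exact: nfold_sumset_msetD.
Qed.

Lemma lengths_convex s m n j : lengths S s m -> lengths S s n ->
  m <= j <= n -> lengths S s j.
Proof.
elim: n s m j => [s m j|n IHn s m j Lm Ln /andP[]].
  by rewrite andbC leqn0 => _ L0 /andP[/eqP->].
(* The length [j = m] is given; any larger [j] is positive, which leaves room to remove an atom
   [b]. *)
rewrite leq_eqVlt => /predU1P[<- //|]; case: j => // j lemj lejn.
have [t Lt [b Ab tbE]] := Ln; rewrite -tbE in Lm *.
apply: nfold_sumset_msetD => //.
have let_s : msubset t (msetD t b) by apply/msubsetP => x; rewrite msetE2 leq_addr.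
(* Since [t] lies in [S], it is not a gap. *)
have [[_ []]|[k lekm Lk]] := divisor_atom_sum Lm let_s.
  exact: (nfold_sumset_sub S_monoid (@atoms_sub S) Lt).
by apply: IHn Lk Lt _; rewrite (leq_trans lekm).
Qed.

End GapAbsorbing.

Theorem theorem5p1 (I : set nat) (hI : I !=set0) (S : set (N_fin I))
    (hS : gap_absorbing S) :
  forall s : N_fin I, S s -> is_nat_interval (lengths S s).
Proof.
move=> s Ss.
have exL : exists n, `[< lengths S s n >].
  by have [n Ln] := factorization Ss; exists n; exact/asboolP.
have ubL n : `[< lengths S s n >] -> n <= size (enum_mset s).
  by move=> /asboolP; exact: lengths_le_size.
(* The endpoints are the least and greatest lengths; convexity fills in the rest. *)
case: (ex_minnP exL) => m /asboolP Lm m_min.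
case: (ex_maxnP exL ubL) => n /asboolP Ln n_max.
exists m, n; split; first exact/m_min/asboolP.
apply/seteqP; split => j /=; last exact: lengths_convex.
by move=> /asboolP Lj; rewrite m_min ?n_max.
Qed.
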